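(* Let $\mathcal{P}$ be an abstract polytope obtained by the following inductive construction process: start with the edge $I$, and in each step construct from every polytope $\mathcal{R}$ obtained so far in the previous step the two new polytopes $\mathcal{R} * pt$ and $\mathcal{R} \times I$. (1) Assume that $\mathcal{P}$ is a prism. (a) If $\mathcal{P} = I^{\times k}$ for some $k \geq 1$, then $Aut(\mathcal{P}) \cong (\mathbb{Z}/2\mathbb{Z})^k \rtimes Sym(k)$. (b) If there exist a pyramid $\mathcal{Q}$ of rank at least $2$ occurring in the construction process and $k \geq 1$ such that $\mathcal{P} = \mathcal{Q} \times I^{\times k}$, then $Aut(\mathcal{P}) \cong Aut(\mathcal{Q}) \times \left( (\mathbb{Z}/2\mathbb{Z})^k \rtimes Sym(k) \right)$. (2) Assume that $\mathcal{P}$ is a pyramid. (a) If $\mathcal{P} = pt^{* k}$ for some $k \geq 1$, then $Aut(\mathcal{P}) \cong Sym(k)$. (b) If there exist a prism $\mathcal{Q}$ of rank at least $2$ and $k \geq 1$ such that $\mathcal{P} = \mathcal{Q} * pt^{* k}$, then $Aut(\mathcal{P}) \cong Aut(\mathcal{Q}) \times Sym(k)$.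
   Context: An abstract polytope $\mathcal{P}$ of rank $n$ ($n\ge -1$) is a partially ordered set such that: (i) it has a minimal element $0_{\mathcal{P}}$ and a maximal element $1_{\mathcal{P}}$; (ii) every maximal totally ordered subset contains exactly $n+2$ elements including $0_{\mathcal{P}}$ and $1_{\mathcal{P}}$; this gives a rank function $rank_{\mathcal{P}}\colon \mathcal{P}\to\{-1,0,\dots,n\}$ with $rank(0_{\mathcal{P}})=-1$ and $rank(1_{\mathcal{P}})=n$; (iii) every section $G/F=\{H\mid F\le H\le G\}$, for $F\le G$ in $\mathcal{P}$ (including $\mathcal{P}=1_{\mathcal{P}}/0_{\mathcal{P}}$), is connected, meaning that either $rank(G)-rank(F)\le 2$, or any two elements $F',G'\in G/F$ different from $F$ and $G$ are joined by a sequence $F'=H^0,H^1,\dots,H^k=G'$ of elements of $G/F$ different from $F$ and $G$ with $H^i$ and $H^{i+1}$ comparable for all $i$; (iv) (diamond condition) for $F\le G$ with $rank(G)-rank(F)=2$ there are exactly two elements $H$ with $F<H<G$. The one-element poset is the polytope of rank $-1$. Polytopes are considered up to order isomorphism. An automorphism is a bijection of the polytope to itself preserving the order in both directions; $Aut(\mathcal{P})$ is the group of automorphisms. The polytopes $pt$ of rank $0$ and $I$ (the edge) of rank $1$ are unique up to isomorphism. For abstract polytopes $\mathcal{P},\mathcal{Q}$, the join is $\mathcal{P}*\mathcal{Q}=\{(F,G)\mid F\in\mathcal{P},G\in\mathcal{Q}\}$ and the Cartesian product is $\mathcal{P}\times\mathcal{Q}=\{(F,G)\mid F\in\mathcal{P},G\in\mathcal{Q},\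 rank_{\mathcal{P}}(F),rank_{\mathcal{Q}}(G)\ge 0\}\cup\{(0_{\mathcal{P}},0_{\mathcal{Q}})\}$, both ordered by $(F,G)\le(F',G')$ iff $F\le F'$ and $G\le G'$. Both are again abstract polytopes. $\mathcal{P}^{*k}$ and $\mathcal{P}^{\times k}$ denote the $k$-fold join and $k$-fold Cartesian product of $\mathcal{P}$ with itself. A pyramid is a polytope of the form $\mathcal{R}*pt$, and a prism is a polytope of the form $\mathcal{R}\times I$, with $\mathcal{R}$ an abstract polytope. $Sym(k)$ is the symmetric group on $k$ letters, and in $(\mathbb{Z}/2\mathbb{Z})^k\rtimes Sym(k)$ the group $Sym(k)$ acts by permuting the coordinates. *)

(* Defs.v *)
From HB Require Import structures.
From mathcomp Require Import all_boot all_order all_fingroup all_algebra.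
From mathcomp Require Import boolp classical_sets cardinality.

Set Implicit Arguments.
Unset Strict Implicit.
Unset Printing Implicit Defensive.

Import Order.TTheory.

Section SignedPerm.
Variable k : nat.

(* The group law of ['Z_2] as a [finGroupType] is addition modulo 2, and that
   of [{dffun ...}] is pointwise. *)
Definition Z2_pow : finGroupType := {dffun forall i : 'I_k, 'Z_2}.

(* Moves the i-th coordinate to position [s i]; the inverse makes this a right
   action. *)
Definition permute_coords (x : Z2_pow) (s : 'S_k) : Z2_pow :=
  [ffun i => x ((s^-1)%g i)].

Lemma permute_coords1 x : permute_coords x 1%g = x.
Proof. by apply/ffunP=> i; rewrite ffunE invg1 perm1. Qed.

Lemma permute_coordsM x : act_morph permute_coords x.
Proof. by move=> s t; apply/ffunP=> i; rewrite !ffunE invMg permM. Qed.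

Definition permute_action : {action 'S_k &-> Z2_pow} :=
  TotalAction permute_coords1 permute_coordsM.

Lemma permute_is_groupAction : is_groupAction [set: Z2_pow] permute_action.
Proof.
move=> s _; rewrite /= inE; apply/andP; split.
  by apply/fintype.subsetP=> x _; rewrite inE.
apply/morphicP=> x y _ _; rewrite !actpermE.
by apply/ffunP=> i; rewrite !ffunE.
Qed.

Definition permute_groupAction := GroupAction permute_is_groupAction.

Definition Z2_wr_Sym : finGroupType := sdprod_by permute_groupAction.

End SignedPerm.

Definition group_iso (G H : groupType) : Prop :=
  exists f : {multiplicative G -> H}, bijective f.

Local Open Scope classical_set_scope.
Local Open Scope card_scope.
Local Open Scope order_scope.

(* Bundling the display lets joins and products, whose displays differ from
   those of their factors, live in one type and be iterated. *)
Record poset := Poset { poset_disp : Order.disp_t;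
                        faces :> porderType poset_disp }.

Definition poset_iso (P Q : poset) : Prop :=
  exists f : P -> Q, bijective f /\ {mono f : F G / F <= G}.

Section AbstractPolytope.
Variable P : poset.
Implicit Types (F G H : P) (C D : set P).

Definition is_least F : Prop := forall G, F <= G.

Definition is_greatest F : Prop := forall G, G <= F.

Definition chain C : Prop := total_on C (fun F G => F <= G).

Definition flag C : Prop := chain C /\ forall D, chain D -> C `<=` D -> D = C.

Definition has_rank F (r : int) : Prop :=
  exists C (m : nat), [/\ flag C, C F, [set H | C H /\ H < F] #= `I_m
                        & r = (m%:Z - 1)%R].

(* When all flags have the same finite cardinality, exactly one r satisfies
   [has_rank F r]; the default value is only used for other posets. *)
Definition rank F : int := xget (-1)%R [set r | has_rank F r].

Definition section_connected F G : Prop :=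
  (rank G - rank F <= 2)%R \/
  forall F' G', F < F' < G -> F < G' < G ->
    exists s : seq P, [/\ path (fun H K => H >=< K) F' s, last F' s = G'
                        & all (fun H => F < H < G) s].

Record polytope_of_rank (n : int) : Prop := PolytopeOfRank {
  polytope_rank_ge : (-1 <= n)%R;
  polytope_least : exists F, is_least F;
  polytope_greatest : exists F, is_greatest F;
  polytope_flag : forall C, flag C -> C #= `I_(absz (n + 2)%R);
  polytope_connected : forall F G, F <= G -> section_connected F G;
  polytope_diamond : forall F G, F <= G -> (rank G - rank F = 2)%R ->
    [set H | F < H < G] #= `I_2
}.

Definition polytope : Prop := exists n, polytope_of_rank n.

End AbstractPolytope.

(* The polytopes of rank 0 and 1: a chain of two faces, and a least face, two
   vertices and a greatest face. *)
Definition pt : poset := Poset bool.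

Definition edge : poset := Poset (bool *p bool)%type.

(* [_ *p _] carries the componentwise order. *)
Definition poset_join (P Q : poset) : poset := Poset (P *p Q)%type.

Definition prod_face (P Q : poset) (x : P *p Q) : bool :=
  `[< ((0 <= rank x.1)%R /\ (0 <= rank x.2)%R) \/
      (is_least x.1 /\ is_least x.2) >].

Record prod_faces (P Q : poset) :=
  ProdFace { prod_pair : P *p Q; _ : prod_face prod_pair }.

HB.instance Definition _ (P Q : poset) := [isSub for @prod_pair P Q].
HB.instance Definition _ (P Q : poset) := [Choice of prod_faces P Q by <:].
HB.instance Definition _ (P Q : poset) :=
  [SubChoice_isSubPOrder of prod_faces P Q by <:
     with Order.prod_display (poset_disp P) (poset_disp Q)].

Definition poset_prod (P Q : poset) : poset := Poset (prod_faces P Q).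

(* k-fold join and product, for k >= 1; the value at k = 0 is irrelevant. *)
Definition join_pow (P : poset) (k : nat) : poset :=
  iter k.-1 (fun R => poset_join R P) P.

Definition prod_pow (P : poset) (k : nat) : poset :=
  iter k.-1 (fun R => poset_prod R P) P.

Definition pyramid (P : poset) : Prop :=
  polytope P /\ exists R, polytope R /\ poset_iso P (poset_join R pt).

Definition prism (P : poset) : Prop :=
  polytope P /\ exists R, polytope R /\ poset_iso P (poset_prod R edge).

(* The last constructor reflects that polytopes are taken up to isomorphism. *)
Inductive constructed : poset -> Prop :=
| constructed_edge : constructed edge
| constructed_join R : constructed R -> constructed (poset_join R pt)
| constructed_prod R : constructed R -> constructed (poset_prod R edge)
| constructed_iso R P : constructed R -> poset_iso R P -> constructed P.

Section Aut.
Variable P : poset.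

Definition is_aut (f : P -> P) : bool :=
  `[< bijective f /\ {mono f : F G / F <= G} >].

Record poset_aut := Aut { poset_aut_fun :> P -> P; _ : is_aut poset_aut_fun }.

HB.instance Definition _ := [isSub for poset_aut_fun].
HB.instance Definition _ := [Choice of poset_aut by <:].

Lemma is_aut_id : is_aut id.
Proof. by apply/asboolP; split=> //; exists id. Qed.

Lemma is_aut_comp (f g : poset_aut) : is_aut (val f \o val g).
Proof.
have [/asboolP[bf mf] /asboolP[bg mg]] := (valP f, valP g).
by apply/asboolP; split=> [|x y]; [exact: bij_comp | rewrite /= mf mg].
Qed.

Lemma aut_inv_ex (f : poset_aut) :
  exists g : poset_aut, cancel (val g) (val f) /\ cancel (val f) (val g).
Proof.
have /asboolP[[g fK gK] mf] := valP f.
have g_aut : is_aut g.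
  apply/asboolP; split=> [|x y]; first by exists (val f).
  by rewrite -mf !gK.
by exists (Sub g g_aut).
Qed.

Definition aut_one : poset_aut := Sub id is_aut_id.
Definition aut_mul (f g : poset_aut) : poset_aut :=
  Sub (val f \o val g) (is_aut_comp f g).
Definition aut_inv (f : poset_aut) : poset_aut := sval (cid (aut_inv_ex f)).

Lemma aut_mulA : associative aut_mul.
Proof. by move=> f g h; apply: val_inj. Qed.

Lemma aut_mul1 : left_id aut_one aut_mul.
Proof. by move=> f; apply: val_inj. Qed.

Lemma aut_mulr1 : right_id aut_one aut_mul.
Proof. by move=> f; apply: val_inj. Qed.

Lemma aut_mulV : left_inverse aut_one aut_inv aut_mul.
Proof.
move=> f; apply: val_inj; rewrite /aut_inv; case: cid => g /= [_ gK].
by apply: funext => x /=; rewrite gK.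
Qed.

Lemma aut_mulrV : right_inverse aut_one aut_inv aut_mul.
Proof.
move=> f; apply: val_inj; rewrite /aut_inv; case: cid => g /= [gK _].
by apply: funext => x /=; rewrite gK.
Qed.

HB.instance Definition _ := isGroup.Build poset_aut
  aut_mulA aut_mul1 aut_mulr1 aut_mulV aut_mulrV.

End Aut.

(* Main.v *)
From HB Require Import structures.
Require Import Defs.
From mathcomp Require Import all_boot all_order all_fingroup all_algebra.
From mathcomp Require Import boolp classical_sets cardinality.

Set Implicit Arguments.
Unset Strict Implicit.
Unset Printing Implicit Defensive.

Import Order.TTheory.
Local Open Scope order_scope.

(** Forgetting the least face turns both constructions into the same one: the
    faces of the join of [P] and [Q] carry the product order of [P] and [Q],
    and the nonleast faces of their Cartesian product carry the product order
    of the nonleast faces ([nonleast_prod]).  No automorphism is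
    lost by dropping the least face ([nonleast_aut]), so every group in the
    theorem is the automorphism group of an order of the form [V ^ k] or
    [X * V ^ k], where [V] is a chain of two elements for joins with points,
    and the poset of the two ends and the body of an edge for products with
    edges.

    For [V ^ k] the idea is to look at facets (coatoms).  A facet of [V ^ k] is
    a coordinate with a facet of [V], and two facets have different coordinates
    exactly when they are different and have a common lower bound.  So an
    automorphism permutes the coordinates and acts on each of them by an
    automorphism of [V] ([rigid_power_aut]); the latter group is trivial for the
    chain and of order two for the edge, whence [Sym(k)] and its signed version.

    For [X * V ^ k] one has to show that automorphisms do not mix the factors.
    It suffices to recognise from the order alone enough facets that are
    full in the [X]-direction to determine the second component of a face: then
    the second component of an image depends only on the second component, and
    a comparison with full faces shows the same for the first one
    ([aut_split]).  When [X] consists of the nonleast faces of a pyramid of rank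
    at least 2, any two facets of [X] meet ([pyramid_coatoms]), and the facets
    coming from the cube are those that are disjoint from some other facet
    ([prod_power_aut]).  When [X] is a prism of rank at least 2, the facets
    opposite to the apexes are the faces [m] such that the faces not below [m]
    are exactly those above some face [a] ([join_power_aut]); the prism [X]
    itself contains no such face ([prism_no_prime]).  The reason is that no
    nonleast face of its base is below all the others, by a separation property
    that holds along the whole construction process and passes to the factors
    of a join ([constructed_separated], [separated_factor]). *)

(** * Group isomorphisms *)

(** Isomorphisms are given below by relations between an automorphism and its
    data, which spares choosing a direction and an explicit inverse. *)
Lemma group_iso_graph (G H : groupType) (R : G -> H -> Prop) :
  (forall g, exists h, R g h) -> (forall h, exists g, R g h) ->
  (forall g h h', R g h -> R g h' -> h = h') ->
  (forall g g' h, R g h -> R g' h -> g = g') ->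
  (forall g g' h h', R g h -> R g' h' -> R (g * g')%g (h * h')%g) ->
  group_iso G H.
Proof.
move=> /choice[f Rf] /choice[e Re] Rfun Rinj RM.
have fM : {morph f : x y / (x * y)%g}.
  by move=> x y; apply: Rfun (Rf _) (RM _ _ _ _ _ _).
pose fm : {multiplicative G -> H} :=
  HB.pack f (isMultiplicative.Build G H f fM).
exists fm; exists e => [g|h].
  by apply: Rinj (Re _) _; exact: Rf.
by apply: Rfun (Rf _) (Re _).
Qed.

Lemma group_iso_refl (G : groupType) : group_iso G G.
Proof.
apply: (@group_iso_graph G G (fun x y => y = x)).
- by move=> x; exists x.
- by move=> x; exists x.
- by move=> x y y' -> ->.
- by move=> x x' y ->.
- by move=> x x' y y' -> ->.
Qed.

Lemma group_iso_sym (G H : groupType) : group_iso G H -> group_iso H G.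
Proof.
move=> [f [g fK gK]]; apply: (@group_iso_graph _ _ (fun y x => y = f x)).
- by move=> y; exists (g y); rewrite gK.
- by move=> x; exists (f x).
- by move=> y x x' -> /(can_inj fK).
- by move=> y y' x -> ->.
- by move=> y y' x x' -> ->; rewrite gmulfM.
Qed.

Lemma group_iso_trans (G H K : groupType) :
  group_iso G H -> group_iso H K -> group_iso G K.
Proof.
move=> [f bf] [g bg]; apply: (@group_iso_graph _ _ (fun x z => z = g (f x))).
- by move=> x; exists (g (f x)).
- move=> z; have [g' gK g'K] := bg; have [f' fK f'K] := bf.
  by exists (f' (g' z)); rewrite f'K g'K.
- by move=> x z z' -> ->.
- by move=> x x' z -> /(bij_inj bg) /(bij_inj bf).
- by move=> x x' z z' -> ->; rewrite !gmulfM.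
Qed.

Lemma group_iso_prod (G G' H H' : groupType) :
  group_iso G G' -> group_iso H H' -> group_iso (G * H)%type (G' * H')%type.
Proof.
move=> [f bf] [g bg].
apply: (@group_iso_graph (G * H)%type (G' * H')%type
          (fun x z => z = (f x.1, g x.2))).
- by move=> x; exists (f x.1, g x.2).
- move=> z; have [g' gK g'K] := bg; have [f' fK f'K] := bf.
  by exists (f' z.1, g' z.2); rewrite f'K g'K; case: z.
- by move=> x z z' -> ->.
- by move=> [x1 x2] [y1 y2] z -> [/(bij_inj bf) -> /(bij_inj bg) ->].
- by move=> x x' z z' -> ->; rewrite !gmulfM.
Qed.

(** * Automorphisms and isomorphisms of posets *)

Section Automorphisms.
Variable P : poset.
Implicit Types f g : poset_aut P.

(** Injectivity is automatic, the order being antisymmetric. *)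
Lemma surj_mono_aut (f : P -> P) :
  (forall y, exists x, f x = y) -> {mono f : x y / x <= y} ->
  exists g : poset_aut P, g =1 f.
Proof.
move=> /choice[e fK] fmono.
have f_aut : is_aut f.
  apply/asboolP; split=> //; exists e => [x|x //].
  by apply/le_anti/andP; split; rewrite -fmono fK.
by exists (Sub f f_aut).
Qed.

Lemma aut_mono f : {mono f : x y / x <= y}.
Proof. by have /asboolP[] := valP f. Qed.

Lemma aut_ext f g : f =1 g -> f = g.
Proof. by move=> fg; apply: val_inj; apply: funext. Qed.

Lemma autM f g x : (f * g)%g x = f (g x).
Proof. by []. Qed.

Lemma autVK f : cancel (f^-1)%g f.
Proof. by move=> x; rewrite -autM mulgV. Qed.

Lemma autKV f : cancel f (f^-1)%g.
Proof. by move=> x; rewrite -autM mulVg. Qed.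

Lemma aut_inj f : injective f.
Proof. exact: can_inj (autKV f). Qed.

Lemma aut_greatest f x : is_greatest (f x) <-> is_greatest x.
Proof.
split=> gr y; last by rewrite -(autVK f y) aut_mono.
by rewrite -(aut_mono f) gr.
Qed.

Lemma aut_least f x : is_least (f x) <-> is_least x.
Proof.
split=> gr y; last by rewrite -(autVK f y) aut_mono.
by rewrite -(aut_mono f) gr.
Qed.

End Automorphisms.

Lemma poset_iso_sym P Q : poset_iso P Q -> poset_iso Q P.
Proof.
move=> [f [[g fK gK] fmono]]; exists g; split; first by exists f.
by move=> x y; rewrite -fmono !gK.
Qed.

Lemma poset_iso_trans P Q R : poset_iso P Q -> poset_iso Q R -> poset_iso P R.
Proof.
move=> [f [bf fmono]] [g [bg gmono]]; exists (g \o f); split.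
  exact: bij_comp.
by move=> x y /=; rewrite gmono fmono.
Qed.

Lemma poset_iso_join P Q Q' :
  poset_iso Q Q' -> poset_iso (poset_join P Q) (poset_join P Q').
Proof.
move=> [f [[g fK gK] fmono]].
exists (fun x : poset_join P Q => (x.1, f x.2) : poset_join P Q'); split.
  by exists (fun x : poset_join P Q' => (x.1, g x.2) : poset_join P Q)
    => [[x1 x2]|[x1 x2]] /=; rewrite ?fK ?gK.
by move=> x y; rewrite !leEprod /= fmono.
Qed.

Lemma poset_iso_aut P Q :
  poset_iso P Q -> group_iso (poset_aut P) (poset_aut Q).
Proof.
move=> [f [[g fK gK] fmono]].
have gmono : {mono g : x y / x <= y} by move=> x y; rewrite -fmono !gK.
apply: (@group_iso_graph _ _
          (fun (u : poset_aut P) (v : poset_aut Q) =>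
             forall x, f (u x) = v (f x))).
- move=> u; have [||v Ev] := @surj_mono_aut Q (f \o u \o g).
  + by move=> y; exists (f ((u^-1)%g (g y))); rewrite /= fK autVK gK.
  + by move=> x y /=; rewrite fmono aut_mono gmono.
  by exists v => x; rewrite Ev /= fK.
- move=> u; have [||v Ev] := @surj_mono_aut P (g \o u \o f).
  + by move=> y; exists (g ((u^-1)%g (f y))); rewrite /= gK autVK fK.
  + by move=> x y /=; rewrite gmono aut_mono fmono.
  by exists v => x; rewrite Ev /= gK.
- by move=> u v v' E E'; apply: aut_ext => x; rewrite -(gK x) -E -E'.
- by move=> u u' v E E'; apply: aut_ext => x; apply: (can_inj fK); rewrite E E'.
- by move=> u u' v v' E E' x; rewrite !autM E E'.
Qed.

Lemma iso_least (P Q : poset) (f : P -> Q) :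
  bijective f -> {mono f : x y / x <= y} ->
  forall x, is_least (f x) <-> is_least x.
Proof.
move=> [g fK gK] fm x; split=> lx y; first by rewrite -fm.
by rewrite -(gK y) fm.
Qed.

Lemma iso_greatest (P Q : poset) (f : P -> Q) :
  bijective f -> {mono f : x y / x <= y} ->
  forall x, is_greatest (f x) <-> is_greatest x.
Proof.
move=> [g fK gK] fm x; split=> lx y; first by rewrite -fm.
by rewrite -(gK y) fm.
Qed.

Lemma join_least (P Q : poset) (x : poset_join P Q) :
  is_least x <-> is_least x.1 /\ is_least x.2.
Proof.
split=> [lx|[l1 l2] y]; last by rewrite leEprod l1 l2.
split=> y; first by have := lx (y, x.2); rewrite leEprod /= => /andP[].
by have := lx (x.1, y); rewrite leEprod /= => /andP[].
Qed.

Lemma join_greatest (P Q : poset) (x : poset_join P Q) :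
  is_greatest x <-> is_greatest x.1 /\ is_greatest x.2.
Proof.
split=> [lx|[l1 l2] y]; last by rewrite leEprod l1 l2.
split=> y; first by have := lx (y, x.2); rewrite leEprod /= => /andP[].
by have := lx (x.1, y); rewrite leEprod /= => /andP[].
Qed.

Lemma pt_least (b : pt) : is_least b <-> b = false.
Proof. by split=> [/(_ false)|->]; [case: b|case]. Qed.

Lemma pt_greatest (b : pt) : is_greatest b <-> b = true.
Proof. by split=> [/(_ true)|->]; [case: b|case]. Qed.

Definition coatom (P : poset) (m : P) : Prop :=
  ~ is_greatest m /\ forall x, m < x -> is_greatest x.

Definition bounded_below (P : poset) (x y : P) : Prop :=
  exists z : P, z <= x /\ z <= y.

Lemma aut_coatom (P : poset) (f : poset_aut P) m : coatom m -> coatom (f m).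
Proof.
move=> [ngm mmax]; split=> [|x]; first by rewrite aut_greatest.
rewrite -(autVK f x) aut_greatest => mx; apply: mmax.
by move: mx; rewrite !lt_neqAle aut_mono (inj_eq (@aut_inj _ f)).
Qed.

Lemma aut_bounded_below (P : poset) (f : poset_aut P) x y :
  bounded_below (f x) (f y) <-> bounded_below x y.
Proof.
split=> -[z [zx zy]]; last by exists (f z); rewrite !aut_mono.
by exists ((f^-1)%g z); split; rewrite -(aut_mono f) autVK.
Qed.

(** * Automorphisms preserving a decomposition *)

(** [mark] singles out elements that are full in the direction of [X] and
    through which elements of [Y] are distinguished from above; being invariant,
    it makes the comparison of second components an invariant notion. *)
Section Split.
Variables X Y : poset.
Variables (topX : X) (topY : Y).
Hypothesis topYP : is_greatest topY.
Let XY := poset_join X Y.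
Variable mark : XY -> Prop.
Hypothesis mark_aut : forall (f : poset_aut XY) m, mark m -> mark (f m).
Hypothesis mark_fst : forall m, mark m -> is_greatest m.1.
Hypothesis mark_sep : forall y y' : Y, ~~ (y <= y') ->
  exists2 m : XY, mark m & (y' <= m.2) && ~~ (y <= m.2).

Lemma le_snd_mark (p q : XY) :
  (p.2 <= q.2) <-> (forall m, mark m -> q <= m -> p <= m).
Proof.
split=> [pq m mm|H].
  rewrite !leEprod => /andP[_ qm]; rewrite (mark_fst mm) /=.
  exact: le_trans pq qm.
apply: contrapT => /negP /mark_sep[m mm /andP[qm /negP[]]].
have := H m mm; rewrite !leEprod !(mark_fst mm) /=; exact.
Qed.

Lemma aut_snd_homo (f : poset_aut XY) (p q : XY) :
  p.2 <= q.2 -> (f p).2 <= (f q).2.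
Proof.
move=> /le_snd_mark H; apply/le_snd_mark => m mm.
rewrite -(autVK f m) !aut_mono; apply: H; exact: mark_aut.
Qed.

Lemma aut_snd_mono (f : poset_aut XY) (p q : XY) :
  ((f p).2 <= (f q).2) = (p.2 <= q.2).
Proof.
apply/idP/idP; last exact: aut_snd_homo.
by move=> /(aut_snd_homo (f^-1)%g); rewrite !autKV.
Qed.

Lemma aut_snd_const (f : poset_aut XY) (p q : XY) :
  p.2 = q.2 -> (f p).2 = (f q).2.
Proof.
by move=> E; apply/le_anti; rewrite !aut_snd_mono E lexx.
Qed.

(** Let [t] be the element above [r] with the same first component and greatest
    second one.  The element with first component that of [f t] and second
    component that of [f r] is below [f t], hence its preimage is below [t], and
    by invariance of second components this preimage is below [r].  So the
    first component of [f t] is at most that of [f r]. *)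
Lemma aut_fst_const (f : poset_aut XY) (p q : XY) :
  p.1 = q.1 -> (f p).1 = (f q).1.
Proof.
suff gen (r : XY) : (f r).1 = (f ((r.1, topY) : XY)).1.
  by move=> E; rewrite gen E -gen.
set t : XY := (r.1, topY).
have rt : f r <= f t by rewrite aut_mono leEprod /= lexx topYP.
apply/le_anti/andP; split; first by move: rt; rewrite leEprod => /andP[].
pose q' : XY := ((f t).1, (f r).2).
suff : q' <= f r by rewrite leEprod => /andP[].
rewrite -(autVK f q') aut_mono leEprod; apply/andP; split; last first.
  by rewrite -(aut_snd_mono f) autVK.
have : (f^-1)%g q' <= t.
  rewrite -(aut_mono f) autVK leEprod lexx /=.
  by move: rt; rewrite leEprod => /andP[].
by rewrite leEprod => /andP[].
Qed.

Lemma aut_split : group_iso (poset_aut XY) (poset_aut X * poset_aut Y)%type.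
Proof.
apply: (@group_iso_graph (poset_aut XY) (poset_aut X * poset_aut Y)%type
  (fun f ab => forall p : XY, f p = (ab.1 p.1, ab.2 p.2) :> XY)).
- move=> f.
  pose a x := (f ((x, topY) : XY)).1; pose b y := (f ((topX, y) : XY)).2.
  have fE p : f p = (a p.1, b p.2) :> XY.
    rewrite [LHS]surjective_pairing; congr (_, _).
      exact: aut_fst_const.
    exact: aut_snd_const.
  have [||a' Ea] := @surj_mono_aut X a.
  + move=> x; pose p := (f^-1)%g ((x, topY) : XY).
    by exists p.1; have := fE p; rewrite autVK => -[].
  + move=> x x'; have := aut_mono f ((x, topY) : XY) ((x', topY) : XY).
    by rewrite !fE !leEprod /= !lexx !andbT.
  have [||b' Eb] := @surj_mono_aut Y b.
  + move=> y; pose p := (f^-1)%g ((topX, y) : XY).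
    by exists p.2; have := fE p; rewrite autVK => -[].
  + move=> y y'; have := aut_mono f ((topX, y) : XY) ((topX, y') : XY).
    by rewrite !fE !leEprod /= !lexx.
  by exists (a', b') => p; rewrite fE /= Ea Eb.
- move=> [a b].
  have [||f Ef] := @surj_mono_aut XY (fun p : XY => (a p.1, b p.2) : XY).
  + move=> [x y]; exists ((a^-1)%g x, (b^-1)%g y) => /=.
    by rewrite !autVK.
  + by move=> p q; rewrite !leEprod /= !aut_mono.
  by exists f => p; rewrite Ef.
- move=> f [a b] [a' b'] /= E E'; congr (_, _); apply: aut_ext => z.
    by have := E (z, topY); rewrite E' => -[->].
  by have := E (topX, z); rewrite E' => -[_ ->].
- by move=> f f' ab E E'; apply: aut_ext => p; rewrite E E'.
- by move=> f f' ab ab' E E' p; rewrite autM E' E.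
Qed.

End Split.

(** * Powers of a poset *)

Section Power.
Variables (V : poset) (k : nat).

Record power_faces := PowerFace { power_coords : {ffun 'I_k -> V} }.

HB.instance Definition _ := [isNew for power_coords].
HB.instance Definition _ := [Choice of power_faces by <:].

Definition coord (c : power_faces) (i : 'I_k) : V := power_coords c i.

Definition power_le (c d : power_faces) : bool :=
  [forall i, coord c i <= coord d i].

Lemma coord_inj (c d : power_faces) : coord c =1 coord d -> c = d.
Proof. by move=> E; apply: val_inj; apply/ffunP. Qed.

Lemma power_le_refl : reflexive power_le.
Proof. by move=> c; apply/forallP. Qed.

Lemma power_le_anti : antisymmetric power_le.
Proof.
move=> c d /andP[/forallP cd /forallP dc]; apply: coord_inj => i.
by apply/le_anti; rewrite cd dc.
Qed.

Lemma power_le_trans : transitive power_le.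
Proof.
move=> d c e /forallP cd /forallP de; apply/forallP => i.
exact: le_trans (cd i) (de i).
Qed.

HB.instance Definition _ := Order.Le_isPOrder.Build (poset_disp V) power_faces
  power_le_refl power_le_anti power_le_trans.

Definition poset_power : poset := Poset power_faces.

Lemma power_leP (c d : poset_power) :
  reflect (forall i, coord c i <= coord d i) (c <= d).
Proof. exact: forallP. Qed.

Definition of_coords (c : 'I_k -> V) : poset_power := PowerFace (finfun c).

Lemma coordE c i : coord (of_coords c) i = c i.
Proof. by rewrite /coord ffunE. Qed.

End Power.
Arguments coord {V k} c i.

Lemma power_not_le (V : poset) k (c d : poset_power V k) :
  ~~ (c <= d) -> exists i, ~~ (coord c i <= coord d i).
Proof. by rewrite -[c <= d]/(power_le c d) negb_forall => /existsP. Qed.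

Lemma poset_power_join (V : poset) (k : nat) (P : poset) :
  poset_iso P (poset_power V k) ->
  poset_iso (poset_join P V) (poset_power V k.+1).
Proof.
move=> [f [[g fK gK] fmono]].
pose h (x : poset_join P V) : poset_power V k.+1 :=
  of_coords (fun i =>
    if unlift ord_max i is Some j then coord (f x.1) j else x.2).
pose h' (c : poset_power V k.+1) : poset_join P V :=
  (g (of_coords (fun j => coord c (lift ord_max j))), coord c ord_max).
have hl x j : coord (h x) (lift ord_max j) = coord (f x.1) j.
  by rewrite coordE liftK.
have hm x : coord (h x) ord_max = x.2 by rewrite coordE unlift_none.
exists h; split.
  exists h' => [[x v]|c].
    rewrite /h' hm; congr (_, _); rewrite -[RHS]fK; congr (g _).
    by apply: coord_inj => j; rewrite coordE hl.
  apply: coord_inj => i; case: (unliftP ord_max i) => [j|] ->.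
    by rewrite hl /= gK coordE.
  by rewrite hm.
move=> x y; rewrite leEprod -fmono;
  apply/power_leP/andP => [H|[/power_leP H H2] i].
  split; last by have := H ord_max; rewrite !hm.
  by apply/power_leP => j; have := H (lift ord_max j); rewrite !hl.
by case: (unliftP ord_max i) => [j|] ->; rewrite ?hl ?hm.
Qed.

Lemma poset_power1 (V : poset) : poset_iso V (poset_power V 1).
Proof.
exists (fun x => of_coords (fun=> x)); split.
  exists (fun c : poset_power V 1 => coord c ord0) => [x|c].
    by rewrite coordE.
  by apply: coord_inj => i; rewrite coordE (ord1 i).
by move=> x y; apply/power_leP/idP => [/(_ ord0)|H i]; rewrite !coordE.
Qed.

(** * Automorphisms of powers *)

(** The facts about the chain of two elements and about the nonleast faces of
    an edge that make the coordinates of their powers recognisable: faces are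
    determined by the facets above them, and different facets do not meet. *)
Record rigid (V : poset) (top : V) : Prop := Rigid {
  rigid_top : is_greatest top;
  rigid_sep : forall x y : V, ~~ (x <= y) ->
    exists2 m : V, coatom m & (y <= m) && ~~ (x <= m);
  rigid_disjoint : forall m m' : V, coatom m -> coatom m' ->
    bounded_below m m' -> m = m';
  rigid_coatom : exists m : V, coatom m
}.

Section RigidPower.
Variables (V : poset) (top : V) (k : nat).
Hypothesis rV : rigid top.
Let topP := rigid_top rV.
Let W := poset_power V k.

Lemma greatest_top x : is_greatest x -> x = top.
Proof. by move=> gx; apply/le_anti; rewrite gx topP. Qed.

Lemma coatom_neq_top m : coatom m -> m <> top.
Proof. by move=> [ng _] E; apply: ng; rewrite E. Qed.

(** For a facet [m] of [V], these are the facets of the power. *)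
Definition axis (i : 'I_k) (x : V) : W :=
  of_coords (fun j => if j == i then x else top).

Lemma axis_same i x : coord (axis i x) i = x.
Proof. by rewrite coordE eqxx. Qed.

Lemma axis_other i j x : j != i -> coord (axis i x) j = top.
Proof. by rewrite coordE => /negPf ->. Qed.

Lemma le_axis (c : W) i x : (c <= axis i x) = (coord c i <= x).
Proof.
apply/power_leP/idP => [/(_ i)|H j]; first by rewrite axis_same.
by have [->|ne] := eqVneq j i; rewrite ?axis_same ?axis_other ?topP.
Qed.

Lemma axis_inj i j m x : coatom m -> axis i m = axis j x -> i = j /\ m = x.
Proof.
move=> /coatom_neq_top mt E; have [ij|ne] := eqVneq i j.
  by split=> //; rewrite -(axis_same i m) E ij axis_same.
by case: mt; rewrite -(axis_same i m) E axis_other.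
Qed.

Lemma power_greatest (c : W) : is_greatest c <-> forall i, coord c i = top.
Proof.
split=> [gc i|E d]; last by apply/power_leP => i; rewrite E topP.
apply: greatest_top => x; rewrite -(coordE (fun=> x) i).
by move: i; apply/power_leP.
Qed.

Lemma axis_coatom i m : coatom m -> coatom (axis i m).
Proof.
move=> cm; have [ngm mmax] := cm; split.
  by move=> /power_greatest /(_ i); rewrite axis_same; exact: coatom_neq_top.
move=> c; rewrite lt_neqAle => /andP[ne /power_leP le].
apply/power_greatest => j; have [->|ji] := eqVneq j i; last first.
  apply/greatest_top => x; apply: (le_trans (topP x)).
  by rewrite -(axis_other m ji).
apply/greatest_top/mmax; rewrite lt_neqAle -{2}(axis_same i m) le andbT.
apply: contraNneq ne => E; apply/eqP/coord_inj => l.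
have [->|li] := eqVneq l i; first by rewrite axis_same.
by apply/le_anti; rewrite le axis_other // topP.
Qed.

Lemma coatom_axis (c : W) : coatom c -> exists i m, coatom m /\ c = axis i m.
Proof.
move=> [ngc cmax].
have /existsP[i ci] : [exists i, coord c i != top].
  rewrite -negb_forall; apply/negP => /forallP H; apply: ngc.
  by apply/power_greatest => i; apply/eqP.
exists i, (coord c i).
pose raise x : W := of_coords (fun l => if l == i then x else coord c l).
have up x : coord c i < x -> forall j, coord (raise x) j = top.
  move=> lt; apply/power_greatest/cmax; rewrite lt_neqAle; apply/andP; split.
    by apply/eqP => E; move: lt; rewrite {1}E coordE eqxx ltxx.
  by apply/power_leP => j; rewrite coordE; case: eqP => [->|_] //; exact: ltW.
have cE j : j != i -> coord c j = top.
  move=> ji; have /up/(_ j) : coord c i < top by rewrite lt_neqAle ci topP.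
  by rewrite coordE (negPf ji).
split; last first.
  apply: coord_inj => j; have [->|ji] := eqVneq j i; first by rewrite axis_same.
  by rewrite axis_other ?cE.
split=> [/greatest_top E|x /up/(_ i)]; first by rewrite E eqxx in ci.
by rewrite coordE eqxx => ->.
Qed.

Lemma axis_bounded i j m m' : i != j -> bounded_below (axis i m) (axis j m').
Proof.
move=> ij; exists (of_coords
  (fun l => if l == i then m else if l == j then m' else top)).
by rewrite !le_axis !coordE !eqxx eq_sym (negPf ij).
Qed.

Lemma axis_bounded_same i m m' : coatom m -> coatom m' ->
  bounded_below (axis i m) (axis i m') -> m = m'.
Proof.
move=> cm cm' [c []]; rewrite !le_axis => cim cim'.
by apply: (rigid_disjoint rV) => //; exists (coord c i).
Qed.

(** Facets on the same coordinate stay together: if they are different they are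
    disjoint, whereas facets on different coordinates always meet. *)
Lemma aut_axis (f : poset_aut W) (i : 'I_k) :
  exists j, forall m, coatom m ->
    exists2 m', coatom m' & f (axis i m) = axis j m'.
Proof.
have [m0 cm0] := rigid_coatom rV.
have [j [m0' [cm0' E0]]] := coatom_axis (aut_coatom f (axis_coatom i cm0)).
exists j => m cm.
have [j' [m' [cm' E]]] := coatom_axis (aut_coatom f (axis_coatom i cm)).
have [jj'|ne] := eqVneq j' j; first by exists m'; rewrite // E jj'.
have := axis_bounded m' m0' ne; rewrite -E -E0 aut_bounded_below.
move=> /(axis_bounded_same cm cm0) mm0.
by exists m0'; rewrite // mm0.
Qed.

Lemma aut_axis_perm (f : poset_aut W) :
  exists s : 'S_k, forall i m, coatom m ->
    exists2 m', coatom m' & f (axis i m) = axis (s i) m'.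
Proof.
have /choice[s sP] := aut_axis f; have [m0 cm0] := rigid_coatom rV.
have s_inj : injective s.
  move=> i j sij; apply/eqP; apply: contrapT => /negP ij.
  have [m cm Em] := sP i _ cm0; have [m' cm' Em'] := sP j _ cm0.
  have := axis_bounded m0 m0 ij; rewrite -(aut_bounded_below f) Em Em' sij.
  move=> /(axis_bounded_same cm cm') mm'.
  move: Em; rewrite mm' sij -Em' => /(@aut_inj _ f) /(axis_inj cm0)[E _].
  by rewrite E eqxx in ij.
by exists (perm s_inj) => i m cm; rewrite permE; apply: sP.
Qed.

(** Once the permutation of the coordinates is known, each coordinate of the
    image of [c] is determined by the facets above it, hence by a single
    coordinate of [c]; evaluating on elements that are full elsewhere shows that
    the resulting maps are automorphisms of [V]. *)
Lemma rigid_power_aut (f : poset_aut W) :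
  exists (s : 'S_k) (a : 'I_k -> poset_aut V),
    forall c i, coord (f c) i = a i (coord c (s i)).
Proof.
have [s sP] := aut_axis_perm f.
have pull i m : coatom m ->
    exists2 m', coatom m' & f (axis i m') = axis (s i) m.
  move=> cm; have := aut_coatom (f^-1)%g (axis_coatom (s i) cm).
  move=> /coatom_axis[j [m' [cm' E]]]; exists m' => //.
  have fE : f (axis j m') = axis (s i) m by rewrite -E autVK.
  have [m'' cm''] := sP j m' cm'; rewrite fE => /(axis_inj cm)[+ _].
  by move=> /perm_inj ij; rewrite -fE ij.
pose a i x := coord (f (axis i x)) (s i).
have fE c i : coord (f c) (s i) = a i (coord c i).
  have facetE m : coatom m -> exists m', forall d,
      (coord (f d) (s i) <= m) = (coord d i <= m').
    move=> /(pull i)[m' _ E]; exists m' => d.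
    by rewrite -!le_axis -E aut_mono.
  apply/le_anti/andP; split; apply: contrapT => /negP.
    move=> /(rigid_sep rV)[m /facetE[m' mE]].
    by rewrite /a !mE axis_same => /andP[->].
  move=> /(rigid_sep rV)[m /facetE[m' mE]].
  by rewrite /a !mE axis_same => /andP[->].
have a_aut i : exists g : poset_aut V, g =1 a i.
  apply: surj_mono_aut => [y|x y].
    exists (coord ((f^-1)%g (axis (s i) y)) i).
    by rewrite -fE autVK axis_same.
  transitivity (axis i x <= axis i y); last by rewrite le_axis axis_same.
  rewrite -(aut_mono f).
  apply/idP/power_leP => [le j|]; last exact.
  have [j' ->] : exists j', j = s j' by exists ((s^-1)%g j); rewrite permKV.
  have [->//|j'i] := eqVneq j' i.
  by rewrite !fE !axis_other.
have /choice[b bE] := a_aut.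
exists (s^-1)%g, (fun i => b ((s^-1)%g i)) => c i.
by rewrite bE -fE permKV.
Qed.

End RigidPower.

(** * Simplices *)

Lemma rigid_pt : @rigid pt true.
Proof.
have coE (m : pt) : coatom m -> m = false.
  by case: m => // -[ng _]; case: ng => -[].
have co0 : @coatom pt false.
  by split=> [/(_ true)|[]] // _ [].
split=> //.
- by case.
- by move=> [] [] // _; exists false.
- by move=> m m' /coE -> /coE ->.
- by exists false.
Qed.

Lemma simplex_aut k : group_iso (poset_aut (poset_power pt k)) 'S_k.
Proof.
have pt_aut (a : poset_aut pt) : a =1 id.
  have am := aut_mono a; have ai := @aut_inj _ a.
  move=> x; have := am false true; have := ai true false.
  by case: x; case: (a true); case: (a false) => // /(_ erefl).
apply: (@group_iso_graph _ _
  (fun (f : poset_aut (poset_power pt k)) (s : 'S_k) =>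
   forall c i, coord (f c) i = coord c (s i))).
- move=> f; have [s [a E]] := rigid_power_aut rigid_pt f.
  by exists s => c i; rewrite E pt_aut.
- move=> s; have [||f Ef] := @surj_mono_aut (poset_power pt k)
    (fun c => of_coords (fun i => coord c (s i))).
  + move=> c; exists (of_coords (fun i => coord c ((s^-1)%g i))).
    by apply: coord_inj => i; rewrite !coordE permK.
  + move=> c d; apply/power_leP/power_leP => H i; last by rewrite !coordE.
    by have := H ((s^-1)%g i); rewrite !coordE permKV.
  by exists f => c i; rewrite Ef coordE.
- move=> f s s' E E'; apply/permP => i; apply/eqP.
  have := E' (@of_coords pt k (fun j => j == s i)) i.
  by rewrite E !coordE eqxx eq_sym => <-.
- by move=> f f' s E E'; apply: aut_ext => c; apply: coord_inj => i;
    rewrite E E'.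
- by move=> f f' s s' E E' c i; rewrite autM E E' permM.
Qed.

Lemma join_pow_power k :
  poset_iso (join_pow pt k.+1) (poset_power pt k.+1).
Proof.
elim: k => [|k IHk]; first exact: poset_power1.
exact: poset_power_join IHk.
Qed.

Lemma power_pt_least k : exists c : poset_power pt k, is_least c.
Proof.
exists (@of_coords pt k (fun=> false)) => c.
by apply/power_leP => i; rewrite coordE le0x.
Qed.

(** * Nonleast faces *)

Section Nonleast.
Variable P : poset.

(** For a polytope these are the faces that may occur as components of the
    nonleast faces of a Cartesian product. *)
Record nonleast_faces := NonleastFace {
  nonleast_face : P; _ : ~~ `[< is_least nonleast_face >] }.

HB.instance Definition _ := [isSub for nonleast_face].
HB.instance Definition _ := [Choice of nonleast_faces by <:].
HB.instance Definition _ :=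
  [SubChoice_isSubPOrder of nonleast_faces by <: with poset_disp P].

Definition nonleast : poset := Poset nonleast_faces.

Lemma nonleast_faceP (x : nonleast) : ~ is_least (nonleast_face x).
Proof. by case: x => x /= /asboolP. Qed.

Lemma nonleast_le (x y : nonleast) : (x <= y) = (nonleast_face x <=
  nonleast_face y).
Proof. by []. Qed.

Definition to_nonleast (x : P) (nx : ~ is_least x) : nonleast :=
  NonleastFace (introN (asboolP _) nx).

(** The least face, being unique, is fixed by every automorphism. *)
Lemma nonleast_aut : group_iso (poset_aut P) (poset_aut nonleast).
Proof.
apply: (@group_iso_graph _ _ (fun (f : poset_aut P) (g : poset_aut nonleast) =>
   forall x, nonleast_face (g x) = f (nonleast_face x))).
- move=> f.
  have nf x : ~ is_least (f (nonleast_face x)).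
    by rewrite aut_least; exact: nonleast_faceP.
  have [||g Eg] := @surj_mono_aut nonleast (fun x => to_nonleast (nf x)).
  + move=> y.
    have ny : ~ is_least ((f^-1)%g (nonleast_face y)).
      by rewrite aut_least; exact: nonleast_faceP.
    by exists (to_nonleast ny); apply: val_inj => /=; rewrite autVK.
  + by move=> x y; rewrite !nonleast_le /= aut_mono.
  by exists g => x; rewrite Eg.
- move=> g.
  pose h x := if pselect (is_least x) is right nx
              then nonleast_face (g (to_nonleast nx)) else x.
  have hl x : is_least x -> h x = x by rewrite /h; case: pselect.
  have hp x : h (nonleast_face x) = nonleast_face (g x).
    rewrite /h; case: pselect => [/nonleast_faceP//|nx].
    by congr (nonleast_face (g _)); apply: val_inj.
  have caseP x : is_least x \/ exists y : nonleast, x = nonleast_face y.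
    by have [lx|nx] := pselect (is_least x); [left|right;
      exists (to_nonleast nx)].
  have [||f Ef] := @surj_mono_aut P h.
  + move=> x; have [lx|[y ->]] := caseP x; first by exists x; rewrite hl.
    by exists (nonleast_face ((g^-1)%g y)); rewrite hp autVK.
  + move=> x y; have [lx|[x' ->]] := caseP x; first by rewrite hl // !lx.
    have [ly|[y' ->]] := caseP y; last by rewrite !hp -!nonleast_le aut_mono.
    rewrite (hl y ly) hp; apply/idP/idP => le; exfalso.
      by apply: (@nonleast_faceP (g x')) => z; exact: le_trans le (ly z).
    by apply: (@nonleast_faceP x') => z; exact: le_trans le (ly z).
  by exists f => x; rewrite Ef hp.
- by move=> f g g' E E'; apply: aut_ext => x; apply: val_inj; rewrite /= E E'.
- move=> f f' g E E'; apply: aut_ext => x.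
  have [lx|nx] := pselect (is_least x); last first.
    by rewrite -[x]/(nonleast_face (to_nonleast nx)) -E E'.
  by apply/le_anti; rewrite !(proj2 (aut_least _ x) lx).
- by move=> f f' g g' E E' x; rewrite !autM E E'.
Qed.

End Nonleast.

(** * Flags and ranks *)

Local Open Scope classical_set_scope.
Local Open Scope card_scope.

(** Zorn's lemma, applied to the sets whose union with [C] is a chain. *)
Lemma flag_extend (P : poset) (C : set P) :
  chain C -> exists2 D, flag D & C `<=` D.
Proof.
move=> chC.
have [F Fch Ftot|A [chA Amax]] := @Zorn_bigcup P (fun A => chain (A `|` C)).
  move=> x y [[A FA Ax]|Cx] [[B FB By]|Cy].
  - have [AB|BA] := Ftot A B FA FB.
      by apply: (Fch B FB); left=> //; exact: AB.
    by apply: (Fch A FA); left=> //; exact: BA.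
  - by apply: (Fch A FA); [left|right].
  - by apply: (Fch B FB); [right|left].
  - exact: chC.
exists (A `|` C); last by move=> x; right.
split=> // D chD AD; apply/seteqP; split=> // x Dx.
have CD : D `|` C = D by apply/setUidPl => y Cy; apply: AD; right.
have [->|AnD] := pselect (A = D); first by left.
suff : A `<` D by move=> /Amax; rewrite CD.
rewrite properEneq; split; first exact/eqP.
by move=> y Ay; apply: AD; left.
Qed.

(** In a grounded poset the condition on ranks that defines the faces of a
    Cartesian product can be read off from the order. *)
Definition grounded (P : poset) : Prop :=
  (exists F : P, is_least F) /\
  forall F : P, (0 <= rank F)%R <-> ~ is_least F.

(** A flag always contains the least face, which is thus counted below every
    other face of the flag. *)
Lemma finite_flags_grounded (P : poset) :
  (exists F : P, is_least F) -> (forall C : set P, flag C -> finite_set C) ->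
  grounded P.
Proof.
move=> [F0 least0] fin; split; first by exists F0.
have flag0 (C : set P) : flag C -> C F0.
  move=> [chC Cmax]; rewrite -(Cmax (C `|` [set F0])); first by right.
    by move=> x y [Cx|->] [Cy|->]; [exact: chC|right|left|left].
  by move=> x; left.
move=> F.
have [D flD FD] : exists2 D : set P, flag D & [set F] `<=` D.
  by apply: flag_extend => x y -> ->; left.
have [m Dm] : finite_set [set H | D H /\ H < F].
  by apply: sub_finite_set (fin D flD) => x [].
have : has_rank F (rank F).
  rewrite /rank; case: xgetP => [r -> //|H].
  by case: (H (m%:Z - 1)%R); exists D, m; split=> //; exact: FD.
move=> [C [n [flC CF Cn ->]]].
case: n Cn => [|n] Cn.
  split=> // nF; exfalso; move: Cn; rewrite II0 card_eq0 => /eqP C0.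
  suff : [set H | C H /\ H < F] F0 by rewrite C0.
  split; first exact: flag0.
  by rewrite lt_neqAle least0 andbT; apply/eqP => E; apply: nF; rewrite -E.
split=> // _ lF.
have C0 : [set H | C H /\ H < F] = set0.
  by apply/seteqP; split=> // x [_]; rewrite lt_neqAle eq_le lF andbT andNb.
by move: Cn; rewrite C0 card_eq_sym card_eq0 => /eqP/seteqP[/(_ 0%N erefl)].
Qed.

Lemma polytope_grounded (P : poset) n : polytope_of_rank P n -> grounded P.
Proof.
move=> pP; apply: finite_flags_grounded; first exact: polytope_least pP.
by move=> C /(polytope_flag pP) Cn; exists (absz (n + 2)%R).
Qed.

(** Finiteness in a form that passes to joins and products by enumeration. *)
Definition listed (P : poset) : Prop := exists s : seq P, forall x, x \in s.

Lemma listed_grounded (P : poset) :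
  (exists F : P, is_least F) -> listed P -> grounded P.
Proof.
move=> least0 [s sP]; apply: finite_flags_grounded => // C _.
by apply: sub_finite_set (finite_seq s) => x _ /=.
Qed.

Lemma listed_join (P Q : poset) :
  listed P -> listed Q -> listed (poset_join P Q).
Proof.
move=> [s sP] [t tP];
  exists (allpairs (fun x y => (x, y) : poset_join P Q) s t).
by move=> [x y]; apply: allpairs_f.
Qed.

Lemma listed_inj (P Q : poset) (f : P -> Q) :
  injective f -> listed Q -> listed P.
Proof.
move=> f_inj [s sQ].
exists (pmap (fun y => if pselect (exists x, f x = y) is left e
                       then Some (sval (cid e)) else None) s).
move=> x; rewrite mem_pmap; apply/mapP; exists (f x) => //.
case: pselect => [e|[]]; last by exists x.
by congr Some; apply: f_inj; case: cid.
Qed.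

(** Otherwise all inner elements of a flag coincide, so that the flag has at
    most three elements, whereas it must have at least four. *)
Lemma rank2_interval (P : poset) n : polytope_of_rank P n -> (2 <= n)%R ->
  exists x y : P, [/\ ~ is_least x, x < y & ~ is_greatest y].
Proof.
move=> pP n2; apply: contrapT => H.
have [F0 least0] := polytope_least pP.
have [F1 greatest1] := polytope_greatest pP.
have [C flC _] := @flag_extend P set0 (fun x y => False_ind _).
pose inner c := [/\ C c, c <> F0 & c <> F1].
have inner_eq x y : inner x -> inner y -> x = y.
  have lt_absurd a b : inner a -> inner b -> ~ a < b.
    move=> [_ a0 _] [_ _ b1] ab; apply: H; exists a, b; split=> // [la|gb].
      by apply: a0; apply/le_anti; rewrite la least0.
    by apply: b1; apply/le_anti; rewrite gb greatest1.
  move=> ix iy; have [chC _] := flC.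
  have [Cx _ _] := ix; have [Cy _ _] := iy; have [xy|yx] := chC x y Cx Cy.
    by move: xy; rewrite le_eqVlt => /orP[/eqP//|/(lt_absurd _ _ ix iy)].
  by move: yx; rewrite le_eqVlt => /orP[/eqP//|/(lt_absurd _ _ iy ix)].
have [z zP] : exists z, forall x, inner x -> x = z.
  have [[z iz]|ni] := pselect (exists z, inner z).
    by exists z => x ix; exact: inner_eq.
  by exists F0 => x ix; case: ni; exists x.
pose f i := nth z [:: F0; F1] i.
have : C #<= `I_3.
  apply: card_le_trans (card_image_le f `I_3).
  apply: subset_card_le => x Cx /=.
  have [->|/eqP x0] := eqVneq x F0; first by exists 0%N.
  have [->|/eqP x1] := eqVneq x F1; first by exists 1%N.
  by exists 2%N => //; rewrite /f /= (zP x).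
have Cn := polytope_flag pP flC.
rewrite (card_le_eql Cn) card_le_II.
by case: n n2 {pP Cn} => // n; rewrite lez_nat -PoszD /= addnC => n2;
  case: n n2 => [|[]].
Qed.

(** * Cartesian products *)

Section Products.
Variables P Q : poset.
Implicit Types p q : poset_prod P Q.

Lemma prod_le p q : (p <= q) =
  ((prod_pair p).1 <= (prod_pair q).1) && ((prod_pair p).2 <= (prod_pair q).2).
Proof. by []. Qed.

Lemma listed_prod : listed P -> listed Q -> listed (poset_prod P Q).
Proof.
move=> lP lQ; apply: (@listed_inj (poset_prod P Q) (poset_join P Q)
  (@prod_pair P Q)).
  by move=> x y; apply: val_inj.
exact: listed_join.
Qed.

Lemma poset_prod_least :
  (exists F : P, is_least F) -> (exists G : Q, is_least G) ->
  exists p, is_least p.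
Proof.
move=> [F lF] [G lG].
have pf : @prod_face P Q (F, G) by apply/asboolP; right.
by exists (ProdFace pf) => q; rewrite prod_le /= lF lG.
Qed.

Hypotheses (gP : grounded P) (gQ : grounded Q).

Lemma prod_faceP (x : P *p Q) :
  reflect (is_least x.1 <-> is_least x.2) (prod_face x).
Proof.
apply: (iffP (asboolP _)); rewrite !(proj2 gP) !(proj2 gQ); first by tauto.
by have [] := pselect (is_least x.1); tauto.
Qed.

Lemma prod_pair_ex (x : P) (y : Q) : (is_least x <-> is_least y) ->
  exists p, prod_pair p = (x, y).
Proof. by move=> xy; exists (ProdFace (introT (prod_faceP (x, y)) xy)). Qed.

Lemma prod_pair_iff p : is_least (prod_pair p).1 <-> is_least (prod_pair p).2.
Proof. by case: p => x /= /prod_faceP. Qed.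

Lemma prod_least p : is_least p <-> is_least (prod_pair p).1.
Proof.
split=> [lp x|l1 q].
  have [[F lF] _] := gP; have [[G lG] _] := gQ.
  have [q Eq] : exists q, prod_pair q = (F, G) by apply: prod_pair_ex; split.
  by have := lp q; rewrite prod_le Eq => /andP[/le_trans le _]; apply/le.
by rewrite prod_le l1 /=; apply/(proj1 (prod_pair_iff p)).
Qed.

(** A face of the product with one nonleast component has both components
    nonleast. *)
Lemma nonleast_prod :
  poset_iso (nonleast (poset_prod P Q)) (poset_join (nonleast P) (nonleast Q)).
Proof.
have n1 (p : nonleast (poset_prod P Q)) :
    ~ is_least (prod_pair (nonleast_face p)).1.
  by rewrite -prod_least; exact: nonleast_faceP.
have n2 (p : nonleast (poset_prod P Q)) :
    ~ is_least (prod_pair (nonleast_face p)).2.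
  by rewrite -prod_pair_iff.
pose f u : poset_join (nonleast P) (nonleast Q) :=
  (to_nonleast (n1 u), to_nonleast (n2 u)).
have fmono : {mono f : u v / u <= v}.
  by move=> u v; rewrite leEprod !nonleast_le /= -prod_le.
have /choice[g fg] : forall y, exists x, f x = y.
  move=> [x y]; have [|p Ep] := @prod_pair_ex (nonleast_face x) (nonleast_face
    y).
    by split=> /nonleast_faceP.
  have np : ~ is_least p by rewrite prod_least Ep; exact: nonleast_faceP.
  by exists (to_nonleast np); congr (_, _); apply: val_inj; rewrite /= Ep.
exists f; split=> //; exists g => // x.
by apply/le_anti/andP; split; rewrite -fmono fg.
Qed.

End Products.

(** * Edges and cubes *)

Lemma edge_least (x : edge) : is_least x <-> x = (false, false).
Proof.
split=> [/(_ (false, false))|-> y]; rewrite leEprod //=.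
by case: x => [[] []].
Qed.

Lemma edge_listed : (exists x : edge, is_least x) /\ listed edge.
Proof.
split; first by exists (false, false); apply/edge_least.
exists [:: (false, false); (false, true); (true, false); (true, true)].
by move=> [[] []].
Qed.

Lemma cube_listed k :
  (exists x : prod_pow edge k.+1, is_least x) /\ listed (prod_pow edge k.+1).
Proof.
have [le fe] := edge_listed.
elim: k => [//|k [IHl IHf]]; split; first exact: poset_prod_least.
exact: listed_prod.
Qed.

Lemma cube_power k :
  poset_iso (nonleast (prod_pow edge k.+1)) (poset_power (nonleast edge) k.+1).
Proof.
elim: k => [|k IHk]; first exact: poset_power1.
apply: poset_iso_trans (poset_power_join IHk).
have [le fe] := edge_listed; have [lc fc] := cube_listed k.
by apply: nonleast_prod; apply: listed_grounded.
Qed.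

Lemma vertex_nonleast b : ~ @is_least edge (b, ~~ b).
Proof. by move/edge_least; case: b. Qed.

Lemma body_nonleast : ~ @is_least edge (true, true).
Proof. by move/edge_least. Qed.

Definition vertex (b : bool) : nonleast edge := to_nonleast (@vertex_nonleast
  b).
Definition body : nonleast edge := to_nonleast body_nonleast.

Lemma nonleast_edgeP (x : nonleast edge) : x = body \/ exists b, x = vertex b.
Proof.
case: x => [[[] []] nx].
- by left; apply: val_inj.
- by right; exists true; apply: val_inj.
- by right; exists false; apply: val_inj.
by exfalso; move: nx => /negP; apply; apply/asboolP/edge_least.
Qed.

Lemma vertex_le b b' : (vertex b <= vertex b') = (b == b').
Proof. by rewrite nonleast_le leEprod; case: b b' => [] []. Qed.

Lemma body_greatest : is_greatest body.
Proof. by move=> x; rewrite nonleast_le leEprod /= !lex1. Qed.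

Lemma body_le_vertex b : (body <= vertex b) = false.
Proof. by rewrite nonleast_le leEprod; case: b. Qed.

Lemma vertex_coatom b : coatom (vertex b).
Proof.
split=> [/(_ body)|x]; first by rewrite body_le_vertex.
have [->|[b' ->]] := nonleast_edgeP x; first by move=> _; exact: body_greatest.
by rewrite lt_neqAle vertex_le => /andP[+ /eqP E]; rewrite E eqxx.
Qed.

Lemma coatom_vertex m : coatom m -> exists b, m = vertex b.
Proof.
by have [->|//] := nonleast_edgeP m => -[]; case; exact: body_greatest.
Qed.

Lemma vertex_bounded b b' : bounded_below (vertex b) (vertex b') -> b = b'.
Proof.
move=> [x []]; have [->|[c ->]] := nonleast_edgeP x;
  first by rewrite body_le_vertex.
by rewrite !vertex_le => /eqP -> /eqP.
Qed.

Lemma rigid_edge : rigid body.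
Proof.
split.
- exact: body_greatest.
- move=> x y; have [->|[b' ->]] := nonleast_edgeP y;
    first by rewrite body_greatest.
  move=> nle; exists (vertex b'); first exact: vertex_coatom.
  by rewrite lexx.
- move=> m m' /coatom_vertex[b ->] /coatom_vertex[b' ->].
  by move=> /vertex_bounded ->.
- by exists (vertex true); exact: vertex_coatom.
Qed.

(** * Signed permutations *)

(** The action on the edge of the group of order two: its nontrivial element
    exchanges the two ends and fixes the body. *)
Definition flip (z : 'Z_2) (x : nonleast edge) : nonleast edge :=
  if (z == 1%g) || `[< x = body >] then x else vertex (~~ (nonleast_face x).1).

Lemma flip_body z : flip z body = body.
Proof. by rewrite /flip asboolT // orbT. Qed.

Lemma flip_vertex z b : flip z (vertex b) = vertex (b (+) (z != 1%g)).
Proof.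
rewrite /flip asboolF ?orbF; last first.
  by move=> E; have := body_le_vertex b; rewrite E lexx.
by case: eqP => _ /=; rewrite ?addbF ?addbT.
Qed.

Lemma Z2M_neq1 (y z : 'Z_2) : ((y * z)%g != 1%g) = (y != 1%g) (+) (z != 1%g).
Proof. by case: y z => [[|[|//]] ?] [[|[|//]] ?]. Qed.

Lemma flipM y z x : flip (y * z)%g x = flip y (flip z x).
Proof.
have [->|[b ->]] := nonleast_edgeP x; first by rewrite !flip_body.
by rewrite !flip_vertex Z2M_neq1 addbAC addbA.
Qed.

Lemma flip1 x : flip 1%g x = x.
Proof. by rewrite /flip eqxx. Qed.

Lemma flip_mono z : {mono flip z : x y / x <= y}.
Proof.
move=> x y; have [->|[b ->]] := nonleast_edgeP x;
  have [->|[b' ->]] := nonleast_edgeP y;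
  rewrite ?flip_body ?flip_vertex ?vertex_le ?body_le_vertex ?body_greatest
    ?lexx //.
by case: b b' (z != 1%g) => [] [] [].
Qed.

Lemma edge_aut (a : poset_aut (nonleast edge)) : exists z, a =1 flip z.
Proof.
have a1 : a body = body.
  have ab := proj2 (aut_greatest a body) body_greatest.
  by apply/le_anti; rewrite body_greatest ab.
have [b ab] := coatom_vertex (aut_coatom a (vertex_coatom true)).
have [b' ab'] := coatom_vertex (aut_coatom a (vertex_coatom false)).
have bb' : b' = ~~ b.
  have := aut_mono a (vertex true) (vertex false).
  by rewrite ab ab' !vertex_le; case: b b' {ab ab'} => [] [].
exists (if b then 1%g else (inZp 1 : 'Z_2)) => x.
have [->|[c ->]] := nonleast_edgeP x; first by rewrite flip_body.
by rewrite flip_vertex; case: c; rewrite ?ab ?ab' ?bb'; congr vertex; case: (b).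
Qed.

Lemma sdM k (u v : Z2_wr_Sym k) :
  ((u * v)%g : 'S_k * Z2_pow k) =
    ((u.1 * v.1)%g, (permute_coords u.2 v.1 * v.2)%g).
Proof. by []. Qed.

(** With [u = (s, x)], the automorphism moves the coordinate [s i] to [i], after
    flipping it according to [x (s i)].  Precomposing coordinates with
    permutations reverses the order of composition, in accordance with the
    product of ['S_k], whose left factor acts first. *)
Lemma cube_aut k :
  group_iso (poset_aut (poset_power (nonleast edge) k)) (Z2_wr_Sym k).
Proof.
apply: (@group_iso_graph _ _
  (fun (f : poset_aut (poset_power (nonleast edge) k)) (u : Z2_wr_Sym k) =>
   forall c i, coord (f c) i = flip (u.2 (u.1 i)) (coord c (u.1 i)))).
- move=> f; have [s [a E]] := rigid_power_aut rigid_edge f.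
  have /choice[z az] := fun i => edge_aut (a i).
  have su : (s, [ffun i => z ((s^-1)%g i)] : Z2_pow k) \in
      finset.setX [set: 'S_k]%SET [set: Z2_pow k]%SET by rewrite !inE.
  exists (SdPair (permute_groupAction k) su) => c i.
  by rewrite E az /= ffunE permK.
- move=> u; have [||f Ef] := @surj_mono_aut (poset_power (nonleast edge) k)
    (fun c => of_coords (fun i => flip (u.2 (u.1 i)) (coord c (u.1 i)))).
  + move=> c; exists (of_coords
        (fun i => flip (u.2 i)^-1%g (coord c ((u.1^-1)%g i)))).
    by apply: coord_inj => i; rewrite !coordE permK -flipM mulgV flip1.
  + move=> c d; apply/power_leP/power_leP => H i;
      last by rewrite !coordE flip_mono.
    by have := H ((u.1^-1)%g i); rewrite !coordE flip_mono permKV.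
  by exists f => c i; rewrite Ef coordE.
- move=> f u v E E'.
  have E1 i : u.1 i = v.1 i.
    apply/eqP; apply: contrapT => /negP ne.
    pose c : poset_power (nonleast edge) k :=
      of_coords (fun j => if j == u.1 i then vertex true else body).
    have := E' c i; rewrite E !coordE eqxx eq_sym (negPf ne) flip_vertex
      flip_body.
    move=> Eb; have := body_le_vertex (true (+) (u.2 (u.1 i) != 1%g)).
    by rewrite Eb lexx.
  have E2 i : u.2 i = v.2 i.
    have := E' (of_coords (fun=> vertex true)) ((u.1^-1)%g i).
    rewrite E -E1 permKV !coordE !flip_vertex => /eqP.
    rewrite eq_le !vertex_le => /andP[/eqP/addbI + _].
    by case: (u.2 i) (v.2 i) => [[|[|//]] ?] [[|[|//]] ?] // _; apply: val_inj.
  apply: val_inj; rewrite [LHS]surjective_pairing [RHS]surjective_pairing.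
  by congr (_, _); [apply/permP|apply/ffunP].
- by move=> f f' s E E'; apply: aut_ext => c; apply: coord_inj => i;
    rewrite E E'.
- move=> f f' u v E E' c i; rewrite autM E E' sdM /= permM -flipM.
  by congr (flip _ _); rewrite !ffunE permK.
Qed.

(** * Disjoint facets in products with a cube *)

(** The marks are the facets that are disjoint from some facet.  Facets that are
    proper in the direction of [X] meet all others: those of the same kind by
    hypothesis, those of the cube because the components can be combined. *)
Lemma prod_power_aut (X V : poset) (top : V) k :
  (exists x : X, is_greatest x) ->
  (forall m m' : X, coatom m -> coatom m' -> bounded_below m m') ->
  rigid top -> (forall m : V, coatom m -> exists2 m', coatom m' & m <> m') ->
  group_iso (poset_aut (poset_join X (poset_power V k)))
            (poset_aut X * poset_aut (poset_power V k))%type.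
Proof.
move=> [topX topXP] bX rV twins; have topP := rigid_top rV.
pose tops := @of_coords V k (fun=> top).
have topsP : is_greatest tops.
  by move=> c; apply/power_leP => i; rewrite coordE topP.
have co1 (m : poset_join X (poset_power V k)) : coatom m ->
    is_greatest m.1 \/ coatom m.1 /\ is_greatest m.2.
  move=> [ngm mmax]; have [g1|ng1] := pselect (is_greatest m.1); first by left.
  right; have up (x : X) : m.1 < x -> is_greatest x /\ is_greatest m.2.
    move=> mx; apply/(join_greatest (x, m.2))/mmax.
    rewrite lt_neqAle leEprod /= lexx (ltW mx) !andbT.
    by apply/eqP => E; move: mx; rewrite E /= ltxx.
  have m_top : m.1 < topX.
    by rewrite lt_neqAle topXP andbT; apply/eqP => E; apply: ng1; rewrite E.
  split; last by have [] := up _ m_top.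
  by split=> // x /up[].
pose twin m m' := ~ @bounded_below (poset_join X (poset_power V k)) m m'.
pose mark m := coatom m /\ exists2 m', coatom m' & twin m m'.
apply: (aut_split topX topsP (mark := mark)).
- move=> f m [cm [m' cm' mm']]; split; first exact: aut_coatom.
  by exists (f m'); [exact: aut_coatom|rewrite /twin aut_bounded_below].
- move=> m [/co1[//|[c1 g2]] [m' /co1 cm' []]]; case: cm' => [g1'|[c1' g2']].
    by exists (m.1, m'.2); rewrite !leEprod /= !lexx g2 g1'.
  have [x [xm xm']] := bX _ _ c1 c1'.
  by exists (x, tops); rewrite !leEprod /= xm xm' g2 g2'.
move=> y y' /power_not_le[i /(rigid_sep rV)[m cm yim]].
have co (m1 : V) : coatom m1 ->
    @coatom (poset_join X (poset_power V k)) (topX, axis top i m1).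
  move=> /(axis_coatom rV i)[ng mmax]; split=> [/join_greatest[_ //]|[x c]].
  rewrite lt_neqAle leEprod /= => /andP[ne /andP[tx le]]; apply/join_greatest.
  have xE : x = topX by apply/le_anti; rewrite topXP tx.
  split; first by rewrite xE.
  apply: mmax; rewrite lt_neqAle le andbT; apply: contraNneq ne => ->.
  by rewrite xE.
exists (topX, axis top i m); last by rewrite /= !(le_axis rV).
split; first exact: co.
have [m' cm' mm'] := twins _ cm; exists (topX, axis top i m'); first exact: co.
move=> [z [zm zm']]; apply: mm'; apply: (axis_bounded_same rV cm cm' (i := i)).
by exists z.2; move: zm zm'; rewrite !leEprod => /andP[_ ->] /andP[_ ->].
Qed.

(** * Facets of pyramids *)

(** A facet of a pyramid is either the base or a pyramid over a facet of the
    base.  Facets of the second kind share the apex; one of them meets the base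
    in a facet of the base, which is not least as the base has positive rank. *)
Lemma pyramid_coatoms (Q : poset) n :
  pyramid Q -> polytope_of_rank Q n -> (2 <= n)%R ->
  forall m m' : nonleast Q, coatom m -> coatom m' -> bounded_below m m'.
Proof.
move=> [_ [R [_ [f [bf fm]]]]] rQ n2.
have [g fK gK] := bf.
have fl := iso_least bf fm; have fg := iso_greatest bf fm.
have [x [y [nx xy ny]]] := rank2_interval rQ n2.
have coatomE (m : nonleast Q) : coatom m ->
    (f (nonleast_face m)).2 = true /\ ~ is_least (f (nonleast_face m)).1 \/
    (f (nonleast_face m)).2 = false /\ is_greatest (f (nonleast_face m)).1.
  move=> [ngm mmax].
  have mmaxQ z : nonleast_face m < z -> is_greatest z.
    move=> mz; have nz : ~ is_least z.
      by move=> lz; move: (lt_le_trans mz (lz (nonleast_face m))); rewrite ltxx.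
    have /mmax gz : m < to_nonleast nz by [].
    move=> w; have [lw|nw] := pselect (is_least w); first exact: lw.
    exact: gz (to_nonleast nw).
  case fE : (f (nonleast_face m)) => [F []] /=; [left|right]; split=> //.
    (* With [F] least, the apex is a facet and the base has only two faces. *)
    move=> lF.
    have nonleast_greatest (u : R) : ~ is_least u -> is_greatest u.
      move=> nu; have : is_greatest (g ((u, true) : poset_join R pt)).
        apply: mmaxQ; rewrite lt_neqAle -fm gK fE leEprod /= lF lexx /= andbT.
        by apply/eqP => mE; apply: nu; move: fE; rewrite mE gK => -[->].
      by rewrite -fg gK => /join_greatest[].
    move: xy; rewrite lt_neqAle -fm -(inj_eq (bij_inj bf)).
    move: nx ny; rewrite -fl -fg join_least join_greatest.
    case: (f x) (f y) => [x1 x2] [y1 y2] /=;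
      rewrite pt_least pt_greatest leEprod /=.
    move=> nx ny /andP[/eqP ne /andP[le1 le2]].
    have [ly|/nonleast_greatest gy] := pselect (is_least y1).
      have lx : is_least x1 by move=> u; exact: le_trans le1 (ly u).
      apply: ne; congr (_, _); first by apply/le_anti; rewrite lx ly.
      by case: x2 y2 le2 nx {ny} => [] [] //= _ [].
    case: y2 ny le2 ne => [[]//|_]; case: x2 nx => // nx _ ne.
    have [lx|/nonleast_greatest gx] := pselect (is_least x1);
      first by apply: nx.
    by apply: ne; congr (_, _); apply/le_anti; rewrite gx gy.
  have : is_greatest (g ((F, true) : poset_join R pt)).
    apply: mmaxQ; rewrite lt_neqAle -fm gK fE leEprod /= lexx andbT.
    by apply/eqP => mE; move: fE; rewrite mE gK.
  by rewrite -fg gK => /join_greatest[].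
have below (u : R) (b : pt) (m m' : nonleast Q) : ~ (is_least u /\ is_least b)
  ->
    (u, b) <= f (nonleast_face m) :> poset_join R pt ->
    (u, b) <= f (nonleast_face m') :> poset_join R pt -> bounded_below m m'.
  move=> nub um um'.
  have nl : ~ is_least (g ((u, b) : poset_join R pt)).
    by rewrite -fl gK join_least.
  by exists (to_nonleast nl); rewrite !nonleast_le /= -!fm gK.
have lR : exists F0 : R, is_least F0.
  have [z lz] := polytope_least rQ; exists (f z).1.
  by move: lz; rewrite -fl join_least => -[].
have [F0 least0] := lR.
move=> m m' /coatomE cm /coatomE cm'.
case: cm => -[m2 m1]; case: cm' => -[m2' m1'].
- apply: (below F0 true); first by rewrite pt_least => -[].
    by rewrite leEprod /= least0 m2.
  by rewrite leEprod /= least0 m2'.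
- apply: (below (f (nonleast_face m)).1 false); first by move=> [].
    by rewrite leEprod /= lexx.
  by rewrite leEprod /= m1'.
- apply: (below (f (nonleast_face m')).1 false); first by move=> [].
    by rewrite leEprod /= m1.
  by rewrite leEprod /= lexx.
- by exists m; rewrite lexx nonleast_le -fm leEprod m2 m1'.
Qed.

(** * Joins with a simplex *)

(** The faces above [a] and those below [m] are complementary, as are in a
    pyramid those above the apex and those below the base. *)
Definition prime_face (P : poset) (m : P) : Prop :=
  exists a : P, forall x, (a <= x) = ~~ (x <= m).

Lemma aut_prime (P : poset) (f : poset_aut P) m :
  prime_face m -> prime_face (f m).
Proof.
move=> [a am]; exists (f a) => x.
by rewrite -(autVK f x) !aut_mono.
Qed.

(** If [m] were not full in the direction of [P], then [a] would have a least
    second component and [m] a greatest one, and [m.1] would be prime in [P]. *)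
Lemma prime_join_greatest (P Q : poset) (m : poset_join P Q) :
  (exists x : P, is_least x) -> (exists x : P, is_greatest x) ->
  (exists y : Q, is_least y) -> (exists y : Q, is_greatest y) ->
  (forall m : P, ~ prime_face m) -> prime_face m -> is_greatest m.1.
Proof.
move=> [p0 lp] [p1 gp] [q0 lq] [q1 gq] nprime [[a1 a2] am].
apply: contrapT => ng.
have m1 : ~~ (p1 <= m.1).
  by apply/negP => le; apply: ng => x; exact: le_trans (gp x) le.
have la2 : is_least a2.
  have := am (p1, q0); rewrite !leEprod /= gp (negPf m1) /= => a2q y.
  exact: le_trans a2q (lq y).
have na : ~~ ((a1, a2) <= m :> poset_join P Q) by rewrite am lexx.
have na1 : ~~ (a1 <= p0).
  apply: contra na => le; rewrite leEprod /= la2 andbT.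
  exact: le_trans le (lp _).
have gm2 : is_greatest m.2.
  have := am (p0, q1); rewrite !leEprod /= (negPf na1) lp /=.
  move=> /esym/negbFE mq y.
  exact: le_trans (gq y) mq.
apply: (nprime m.1); exists a1 => x.
by have := am (x, q0); rewrite !leEprod /= la2 gm2 !andbT.
Qed.

(** The marks are the prime faces, which are the faces opposite to the vertices
    of the simplex. *)
Lemma join_power_aut (Q : poset) k :
  (exists x : Q, is_least x) -> (exists x : Q, is_greatest x) ->
  (forall m : Q, ~ prime_face m) ->
  group_iso (poset_aut (poset_join Q (poset_power pt k)))
            (poset_aut Q * poset_aut (poset_power pt k))%type.
Proof.
move=> [bot botP] [top topP] nprime.
pose ones := @of_coords pt k (fun=> true).
have onesP : is_greatest ones.
  by move=> c; apply/power_leP => i; rewrite coordE lex1.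
apply: (aut_split top onesP
          (mark := @prime_face (poset_join Q (poset_power pt k)))).
- by move=> f m; exact: aut_prime.
- move=> m; apply: prime_join_greatest => //.
  + by exists bot.
  + by exists top.
  + exact: power_pt_least.
  + by exists ones.
move=> y y' /power_not_le[i yi].
have [y'0 y1] : coord y' i = false /\ coord y i = true.
  by case: (coord y i) (coord y' i) yi => [] [].
(* The facet opposite to the [i]-th vertex of the simplex. *)
exists (top, axis (true : pt) i false).
  exists (bot, @of_coords pt k (fun j => j == i)) => x.
  rewrite !leEprod botP topP /= (le_axis rigid_pt).
  apply/power_leP/idP => [/(_ i)|xi j]; rewrite coordE.
    by rewrite eqxx; case: (coord x.2 i).
  by have [->|_] := eqVneq j i; [case: (coord x.2 i) xi|rewrite le0x].
by rewrite /= !(le_axis rigid_pt) y'0 y1.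
Qed.

(** * Bases of prisms *)

(** Below a face that is neither least nor a vertex, the nonleast faces have no
    least element. *)
Definition separated (P : poset) : Prop :=
  forall a y : P, ~ is_least a -> a < y ->
  exists z, [/\ z <= y, ~ is_least z & ~~ (a <= z)].

Lemma separated_iso P Q : poset_iso P Q -> separated P -> separated Q.
Proof.
move=> [f [bf fm]] sP a y; have [g fK gK] := bf.
have fl := iso_least bf fm.
rewrite -(gK a) -(gK y) fl lt_neqAle (inj_eq (bij_inj bf)) fm -lt_neqAle.
move=> na /(sP _ _ na)[z [zy nz az]]; exists (f z).
by split; rewrite ?fm ?fl.
Qed.

Lemma edge_separated : separated edge.
Proof.
move=> a y na ay; pose z : edge := (~~ a.1, ~~ a.2).
move: na ay; rewrite edge_least lt_neqAle leEprod.
exists z; split; rewrite ?edge_least ?leEprod /z.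
- by case: a y na ay {z} => [[] []] [[] []] //= [].
- by case: a y na ay {z} => [[] []] [[] []].
by case: a na {ay z} => [[] []] // [].
Qed.

Lemma pyramid_separated (R : poset) :
  (exists x : R, is_least x) -> separated R -> separated (poset_join R pt).
Proof.
move=> [F0 least0] sR [a1 a2] [y1 y2].
rewrite join_least pt_least lt_neqAle leEprod /= => na /andP[ne /andP[le1 le2]].
have [la|na1] := pselect (is_least a1).
  have a2E : a2 = true by case: a2 na {ne le2} => // -[].
  have y2E : y2 = true by move: le2; rewrite a2E; case: y2 {ne}.
  exists (y1, false); split.
  - by rewrite leEprod /= lexx.
  - rewrite join_least /= => -[ly _]; move: ne => /eqP; apply.
    by rewrite a2E y2E; congr (_, _); apply/le_anti; rewrite la ly.
  - by rewrite leEprod a2E andbF.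
have [E|ne1] := eqVneq a1 y1; last first.
  have [|z [zy nz az]] := sR a1 y1 na1; first by rewrite lt_neqAle ne1.
  exists (z, false); split.
  - by rewrite leEprod /= zy.
  - by rewrite join_least => -[].
  - by rewrite leEprod negb_and az.
exists (F0, true); split.
- rewrite leEprod /= least0.
  by move: ne le2; rewrite E; case: (a2) (y2) => [] []; rewrite ?eqxx.
- by rewrite join_least pt_least => -[].
rewrite leEprod; apply/negP => /andP[a0 _].
by apply: na1 => z; exact: le_trans a0 (least0 z).
Qed.

Lemma prism_separated (R : poset) :
  grounded R -> separated R -> separated (poset_prod R edge).
Proof.
move=> gR sR.
have gE := listed_grounded (proj1 edge_listed) (proj2 edge_listed).
move=> a y; rewrite prod_least // => na.
have na2 : ~ is_least (prod_pair a).2 by rewrite -prod_pair_iff.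
rewrite lt_neqAle prod_le => /andP[ne /andP[le1 le2]].
have nle (P : poset) (u v : P) : ~ is_least u -> u <= v -> ~ is_least v.
  by move=> nu uv lv; apply: nu => w; exact: le_trans uv (lv w).
have ny1 := nle _ _ _ na le1; have ny2 := nle _ _ _ na2 le2.
have [E1|ne1] := eqVneq (prod_pair a).1 (prod_pair y).1; last first.
  have [|z [zy nz az]] := sR _ (prod_pair y).1 na;
    first by rewrite lt_neqAle ne1.
  have [|p Ep] := @prod_pair_ex _ _ gR gE z (prod_pair y).2; first by split.
  exists p; split.
  - by rewrite prod_le Ep /= zy lexx.
  - by rewrite prod_least // Ep.
  - by rewrite prod_le Ep negb_and az.
have [|z [zy nz az]] := edge_separated na2 (_ : _ < (prod_pair y).2).
  rewrite lt_neqAle le2 andbT; apply: contraNneq ne => E2.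
  apply/eqP/val_inj; rewrite /= [LHS]surjective_pairing [RHS]surjective_pairing.
  by rewrite E1 E2.
have [|p Ep] := @prod_pair_ex _ _ gR gE (prod_pair y).1 z; first by split.
exists p; split.
- by rewrite prod_le Ep /= zy lexx.
- by rewrite prod_least // Ep.
- by rewrite prod_le Ep negb_and az orbT.
Qed.

Lemma constructed_separated P : constructed P ->
  [/\ exists x : P, is_least x, listed P & separated P].
Proof.
elim=> {P} [|R _ [lR fR sR]|R _ [lR fR sR]|R P _ [lR fR sR] RP].
- by have [le fe] := edge_listed; split=> //; exact: edge_separated.
- split; last exact: pyramid_separated.
    by have [x lx] := lR; exists (x, false); rewrite join_least pt_least.
  by apply: listed_join => //; exists [:: false; true] => -[].
- have [le fe] := edge_listed; split; first exact: poset_prod_least.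
    exact: listed_prod.
  by apply: prism_separated => //; exact: listed_grounded.
- have [f [bf fm]] := RP; split; last exact: separated_iso sR.
    by have [x lx] := lR; exists (f x); rewrite (iso_least bf fm).
  have [g [bg _]] := poset_iso_sym RP.
  exact: listed_inj (bij_inj bg) fR.
Qed.

(** The faces with least second component form a lower set isomorphic to [P],
    and the condition only concerns what lies below a given face. *)
Lemma separated_factor (P Q : poset) :
  separated (poset_join P Q) -> (exists y : Q, is_least y) -> separated P.
Proof.
move=> sPQ [b lb] a y na ay.
have [||[z c] [zy nz az]] := sPQ (a, b) (y, b).
- by rewrite join_least => -[].
- rewrite lt_neqAle leEprod /= (ltW ay) lexx !andbT.
  by apply/eqP => -[E]; rewrite E ltxx in ay.
move: zy az; rewrite !leEprod lb /= andbT => /andP[zy cb] az.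
exists z; split=> // lz; apply: nz; rewrite join_least; split=> // w.
exact: le_trans cb (lb w).
Qed.

(** Suppose that the faces that are not below [m] are exactly those above [a].
    Since [a] misses one of the two copies of the base [R], this copy is below
    [m]; and since the [R]-component of [a] is not below every nonleast face of
    [R], some product of such a face with the edge is also below [m].  Then
    [m] is greatest, hence above [a], which is absurd. *)
Lemma prism_no_prime (Q : poset) n :
  separated Q -> prism Q -> polytope_of_rank Q n -> (2 <= n)%R ->
  forall m : Q, ~ prime_face m.
Proof.
move=> sQ [_ [R [[r rR] [f [bf fm]]]]] rQ n2 m [a am].
have [g fK gK] := bf; have gg x y : g x <= g y = (x <= y) by rewrite -fm !gK.
have fl := iso_least bf fm; have fg := iso_greatest bf fm.
have gR := polytope_grounded rR.
have gE := listed_grounded (proj1 edge_listed) (proj2 edge_listed).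
have [top topP] := polytope_greatest rR.
have mk (x : R) (y : edge) : ~ is_least x -> ~ is_least y ->
    exists p : poset_prod R edge, prod_pair p = (x, y).
  by move=> nx ny; apply: prod_pair_ex.
have edge_top (y : edge) : y <= (true, true).
  by rewrite leEprod /= !lex1.
have nonleast2 (p : poset_prod R edge) :
    ~ is_least p -> ~ is_least (prod_pair p).1 /\ ~ is_least (prod_pair p).2.
  by rewrite prod_least // -prod_pair_iff.
have ntop : ~ is_least top.
  have [x [y [nx xy _]]] := rank2_interval rQ n2 => lt.
  apply: nx; rewrite -fl prod_least // => z.
  exact: le_trans (topP _) (lt z).
(* If [w] is below all nonleast faces of [R], then separation below an end of
   the prism forces [w] to be greatest, so that [R] is a point and [Q] an
   edge. *)
have sR (w : R) : ~ is_least w -> exists2 u, ~ is_least u & ~~ (w <= u).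
  move=> nw; apply: contrapT => H.
  have wle u : ~ is_least u -> w <= u.
    by move=> nu; apply: contrapT => /negP wu; apply: H; exists u.
  have [p Ep] := mk w (true, false) nw (@vertex_nonleast true).
  have [q Eq] := mk top (true, false) ntop (@vertex_nonleast true).
  have [wt|wt] := eqVneq w top.
    have [x [y [nx xy ny]]] := rank2_interval rQ n2.
    have gt1 z : ~ is_least z -> (prod_pair (f z)).1 = top.
      rewrite -fl => /nonleast2[+ _] => /wle; rewrite wt => le.
      by apply/le_anti; rewrite topP le.
    have ny0 : ~ is_least y.
      by move=> ly; move: (lt_le_trans xy (ly x)); rewrite ltxx.
    have [_ nx2] := nonleast2 (f x) (fun l => nx (proj1 (fl x) l)).
    apply: ny; rewrite -fg => z; rewrite prod_le gt1 // topP /=.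
    move: xy; rewrite lt_neqAle -(inj_eq (bij_inj bf)) -fm prod_le !gt1 //.
    rewrite lexx /=.
    rewrite -(inj_eq val_inj) /= [prod_pair (f x)]surjective_pairing.
    rewrite [prod_pair (f y)]surjective_pairing !gt1 // xpair_eqE eqxx /=.
    move: nx2; rewrite edge_least.
    case: (prod_pair (f x)).2 (prod_pair (f y)).2 => [[] []] [[] []] //= nx2;
      by rewrite ?leEprod //= ?lex1 // => _; case: nx2.
  have [||z [zq nz pz]] := sQ (g p) (g q).
  - by rewrite -fl gK prod_least // Ep.
  - rewrite lt_neqAle gg prod_le Ep Eq /= topP lexx !andbT.
    apply: contraNneq wt => /(bij_inj (Bijective gK fK)) pq.
    by move: Ep; rewrite pq Eq => -[->].
  have [nz1 nz2] := nonleast2 (f z) (fun l => nz (proj1 (fl z) l)).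
  move: pz zq; rewrite -!fm !gK !prod_le Ep Eq /= (wle _ nz1) /= topP /=.
  by move: nz2; rewrite edge_least; case: (prod_pair (f z)).2 => [[] []];
    rewrite ?leEprod.
have amf x : (f a <= x) = ~~ (x <= f m) by rewrite -(gK x) !fm.
have nam : ~~ (f a <= f m) by rewrite amf lexx.
have [na1 na2] :
    ~ is_least (prod_pair (f a)).1 /\ ~ is_least (prod_pair (f a)).2.
  by apply: nonleast2 => la; move: nam; rewrite la.
have {}amf x : ~~ (f a <= x) -> x <= f m by rewrite amf negbK.
have [u nu au] := sR _ na1.
have [p Ep] := mk u (true, true) nu body_nonleast.
have [b ab] : exists b : bool, ~~ ((prod_pair (f a)).2 <= ((b, ~~ b) : edge)).
  move: na2; rewrite edge_least.
  case: (prod_pair (f a)).2 => [[] []] na2;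
    [exists true|exists false|exists true|];
    by rewrite ?leEprod //; case: na2.
have [q Eq] := mk top (b, ~~ b) ntop (@vertex_nonleast b).
have : p <= f m by apply: amf; rewrite prod_le Ep negb_and au.
have : q <= f m by apply: amf; rewrite prod_le Eq negb_and ab orbT.
rewrite !prod_le Ep Eq /= => /andP[m1 _] /andP[_ m2].
move/negP: nam; apply; rewrite prod_le.
by rewrite (le_trans (topP _) m1) (le_trans (edge_top _) m2).
Qed.

(** * Automorphism groups of the constructed polytopes *)

Theorem mainTheorem1 (P : poset) (hP : constructed P) :
  (prism P ->
    (forall k : nat, (1 <= k)%N -> poset_iso P (prod_pow edge k) ->
       group_iso (poset_aut P) (Z2_wr_Sym k)) /\
    (forall (Q : poset) (n : int) (k : nat),
       constructed Q -> pyramid Q -> polytope_of_rank Q n -> (2 <= n)%R ->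
       (1 <= k)%N -> poset_iso P (poset_prod Q (prod_pow edge k)) ->
       group_iso (poset_aut P) (poset_aut Q * Z2_wr_Sym k)%type)) /\
  (pyramid P ->
    (forall k : nat, (1 <= k)%N -> poset_iso P (join_pow pt k) ->
       group_iso (poset_aut P) 'S_k) /\
    (forall (Q : poset) (n : int) (k : nat),
       prism Q -> polytope_of_rank Q n -> (2 <= n)%R ->
       (1 <= k)%N -> poset_iso P (poset_join Q (join_pow pt k)) ->
       group_iso (poset_aut P) (poset_aut Q * 'S_k)%type)).
Proof.
split=> _; split.
- case=> // k _ /poset_iso_aut/group_iso_trans; apply.
  apply: group_iso_trans (nonleast_aut _) _.
  exact: group_iso_trans (poset_iso_aut (cube_power k)) (cube_aut _).
- move=> Q n [//|k] _ pQ rQ n2 _ /poset_iso_aut/group_iso_trans; apply.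
  apply: group_iso_trans (nonleast_aut _) _.
  have [lc fc] := cube_listed k.
  have iso := poset_iso_trans
    (nonleast_prod (polytope_grounded rQ) (listed_grounded lc fc))
    (poset_iso_join (nonleast Q) (cube_power k)).
  apply: group_iso_trans (poset_iso_aut iso) _.
  apply: group_iso_trans (prod_power_aut _ _ _ rigid_edge _) _.
  + have [x [y [nx xy _]]] := rank2_interval rQ n2.
    have [top topP] := polytope_greatest rQ.
    have nt : ~ is_least top.
      by move=> lt; apply: nx => z; exact: le_trans (topP _) (lt z).
    by exists (to_nonleast nt) => z; rewrite nonleast_le topP.
  + exact: pyramid_coatoms rQ n2.
  + move=> m /coatom_vertex[b ->]; exists (vertex (~~ b));
      first exact: vertex_coatom.
    by move=> E; have := vertex_le b (~~ b); rewrite -E lexx; case: b {E}.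
  exact: group_iso_prod (group_iso_sym (nonleast_aut Q)) (cube_aut _).
- case=> // k _ /poset_iso_aut/group_iso_trans; apply.
  exact: group_iso_trans (poset_iso_aut (join_pow_power k)) (simplex_aut _).
- move=> Q n [//|k] pQ rQ n2 _ isoP; have [_ _ sP] := constructed_separated hP.
  have {}isoP := poset_iso_trans isoP (poset_iso_join Q (join_pow_power k)).
  have sQ := separated_factor (separated_iso isoP sP) (power_pt_least k.+1).
  apply: group_iso_trans (poset_iso_aut isoP) _.
  apply: group_iso_trans (join_power_aut _ _ _ _) _.
  + exact: polytope_least rQ.
  + exact: polytope_greatest rQ.
  + exact: prism_no_prime sQ pQ rQ n2.
  exact: group_iso_prod (group_iso_refl _) (simplex_aut _).
Qed.
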